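(* Let $k,m$ be positive integers with $k<m<2k$, and for $n\ge 0$ let $h_k(m,n)$ denote the number of tilings of an $m\times n$ rectangle with $k\times 1$ tiles. Then, as formal power series in $x$, $$\sum_{n\geq 0}h_k(m,n)x^n=\frac{(1-x^k)^{k-1}}{(1-x^k)^k-(m-k+1)x^k}.$$
   Context: The $m\times n$ rectangle is placed with its bottom left corner at the origin, with a side of length $m$ along the $y$-axis and a side of length $n$ along the $x$-axis, and is divided into unit cells. A tiling with $k\times 1$ tiles is a partition of the cells of the rectangle into tiles, each of which is either a horizontal row of $k$ consecutive cells (a horizontal tile, extending parallel to the $x$-axis) or a vertical column of $k$ consecutive cells (a vertical tile, extending parallel to the $y$-axis); both orientations are allowed. Tilings are counted as distinct configurations (not up to symmetry). Convention: $h_k(m,0)=1$ (the empty tiling). *)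

(* Defs.v *)
From mathcomp Require Import all_boot all_order all_algebra.

Set Implicit Arguments.
Unset Strict Implicit.
Unset Printing Implicit Defensive.

Import GRing.Theory.

(* The cell (i, j) is the unit square [j, j+1] x [i, i+1]: the first component
   is the coordinate along the y-axis, the second one along the x-axis. *)
Definition cell (m n : nat) : finType := ('I_m * 'I_n)%type.

Section Tilings.

Variables (k m n : nat).

Definition horizontal_tile (B : {set cell m n}) : bool :=
  [exists i : 'I_m, exists j : 'I_n,
    (j + k <= n) && (B == [set c : cell m n | (c.1 == i) && (j <= c.2 < j + k)])].

Definition vertical_tile (B : {set cell m n}) : bool :=
  [exists i : 'I_m, exists j : 'I_n,
    (i + k <= m) && (B == [set c : cell m n | (c.2 == j) && (i <= c.1 < i + k)])].

Definition is_tiling (P : {set {set cell m n}}) : bool :=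
  partition P [set: cell m n] &&
  [forall B in P, horizontal_tile B || vertical_tile B].

Definition num_tilings : nat := #|[set P | is_tiling P]|.

End Tilings.

Local Open Scope ring_scope.

(* A formal power series is its sequence of coefficients. *)
Definition fps (R : Type) : Type := nat -> R.

Section PowerSeries.

Variable R : comUnitRingType.

Definition fps_of_poly (p : {poly R}) : fps R := fun n => p`_n.

Definition fps_mul (f g : fps R) : fps R :=
  fun n => \sum_(i < n.+1) f i * g (n - i)%N.

(* The first n coefficients of 1 / f, by the usual recursion; see fps_mulfV. *)
Fixpoint fps_inv_coefs (f : fps R) (n : nat) : seq R :=
  if n is n'.+1 then
    let s := fps_inv_coefs f n' in
    rcons s ((f 0%N)^-1 * ((n' == 0%N)%:R - \sum_(i < n') s`_i * f (n' - i)%N))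
  else [::].

Definition fps_inv (f : fps R) : fps R := fun n => (fps_inv_coefs f n.+1)`_n.

Definition fps_div (f g : fps R) : fps R := fps_mul f (fps_inv g).

Lemma size_fps_inv_coefs f n : size (fps_inv_coefs f n) = n.
Proof. by elim: n => //= n IHn; rewrite size_rcons IHn. Qed.

Lemma nth_fps_inv_coefs f n i :
  (i < n)%N -> (fps_inv_coefs f n)`_i = fps_inv f i.
Proof.
elim: n => // n IHn; rewrite ltnS leq_eqVlt => /predU1P[-> //|lt_in].
by rewrite /= nth_rcons size_fps_inv_coefs lt_in IHn.
Qed.

Lemma fps_invE f n :
  fps_inv f n =
    (f 0%N)^-1 * ((n == 0%N)%:R - \sum_(i < n) fps_inv f i * f (n - i)%N).
Proof.
rewrite {1}/fps_inv /= nth_rcons size_fps_inv_coefs ltnn eqxx.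
by congr (_ * (_ - _)); apply: eq_bigr => i _; rewrite nth_fps_inv_coefs.
Qed.

Lemma fps_mulC f g : fps_mul f g =1 fps_mul g f.
Proof.
move=> n; rewrite /fps_mul (reindex_inj rev_ord_inj) /=.
by apply: eq_bigr => i _; rewrite mulrC subSS subKn // -ltnS.
Qed.

Lemma fps_mulfV f :
  f 0%N \is a GRing.unit -> fps_mul f (fps_inv f) =1 fps_of_poly 1.
Proof.
move=> f0U n; rewrite fps_mulC /fps_mul /fps_of_poly coef1 big_ord_recr /=.
by rewrite subnn (fps_invE f n) mulrC mulVKr // addrC subrK.
Qed.

End PowerSeries.

(* Main.v *)
Require Import Defs.
From mathcomp Require Import all_boot all_order all_algebra zify.

Import GRing.Theory.

(* As k < m < 2k, a column meets at most one vertical tile, and every vertical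
   tile meets row k - 1.  Read the tiling from left to right.  Once a vertical
   tile occupies rows i, ..., i + k - 1, the other rows are forced to continue
   with horizontal tiles, so that the left boundary of the rest is notched and
   the next vertical tile must lie in the same k rows; the boundary is straight
   again only after k such tiles.  Between two consecutive vertical tiles there
   is room for any number of stacks of k horizontal tiles, each counted by
   x^k.  Hence, with u := 1 - x^k, M := m - k + 1 and B_d the generating function
   of the regions with a notch of depth d,
     u B_d = B_(d-1) for 0 < d < k,   u B_0 = 1 + M x^k B_(k-1),
   which B_d = u^(k-1-d) / (u^k - M x^k) satisfies. *)

(** * Tilings of an arbitrary set of cells *)

Section TilingsOfRegions.

Variables k m n : nat.
Implicit Types (D B : {set cell m n}) (P : {set {set cell m n}}).
Implicit Types E : nat -> nat -> bool.

Definition is_tile B := horizontal_tile k B || vertical_tile k B.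

Definition tilings D : {set {set {set cell m n}}} :=
  [set P | partition P D && [forall B in P, is_tile B]].

Lemma tilings_block P D B : P \in tilings D -> B \in P -> is_tile B.
Proof. by rewrite inE => /andP[_ /forall_inP]; apply. Qed.

Lemma tilingsD1 P D B :
  P \in tilings D -> B \in P -> P :\ B \in tilings (D :\: B).
Proof.
move=> tP PB; have:= tP; rewrite !inE => /andP[partP _].
rewrite partitionD1 //; apply/forall_inP => C; rewrite !inE => /andP[_].
exact: tilings_block tP.
Qed.

Lemma tilingsU1 P D B :
    P \in tilings (D :\: B) -> B \subset D -> B != set0 -> is_tile B ->
  B |: P \in tilings D.
Proof.
move=> tP sBD nB tB; have:= tP; rewrite !inE => /andP[partP _].
have -> : D = B :|: (D :\: B) by rewrite setDE setUIr setUCr setIT (setUidPr sBD).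
rewrite partitionU1 //; last by rewrite disjoints_subset setCD subsetUr.
by apply/forall_inP => C; rewrite !inE => /predU1P[->|/(tilings_block _ _ _ tP)].
Qed.

(** Tilings are sorted by the block [B] that covers [x]; deleting [B] is a bijection onto the
    tilings of [D :\: B], with inverse [B |: P]. *)
Lemma card_tilings_split D x : x \in D ->
  #|tilings D| =
    \sum_(B | [&& is_tile B, x \in B & B \subset D]) #|tilings (D :\: B)|.
Proof.
move=> xD.
have cvx P : P \in tilings D -> x \in cover P.
  by rewrite inE => /andP[/cover_partition-> _].
have blkP P : P \in tilings D -> pblock P x \in P.
  by move=> /cvx; apply: pblock_mem.
rewrite -sum1_card
  (partition_big (pblock^~ x) (fun B => [&& is_tile B, x \in B & B \subset D]));
  last first.
  move=> P tP; rewrite (tilings_block _ _ _ tP) ?blkP // mem_pblock cvx //=.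
  have:= tP; rewrite inE => /andP[/cover_partition <- _].
  by apply: (@bigcup_sup _ _ (pblock P x)); apply: blkP.
apply: eq_bigr => B /and3P[tB xB sBD].
have nB : B != set0 by apply/set0Pn; exists x.
have BnQ Q : Q \in tilings (D :\: B) -> B \notin Q.
  rewrite inE => /andP[/cover_partition cQ _]; apply/negP => QB.
  suff: x \in D :\: B by rewrite !inE xB.
  by rewrite -cQ; apply/bigcupP; exists B.
rewrite sum1_card.
rewrite -(card_in_imset (f := fun Q => B |: Q) (D := tilings (D :\: B))).
  apply: eq_card => P; apply/andP/imsetP => [[tP /eqP pB]|[Q tQ ->]].
    have PB : B \in P by rewrite -pB blkP.
    by exists (P :\ B); rewrite ?tilingsD1 ?setD1K.
  have tBQ := tilingsU1 _ _ _ tQ sBD nB tB; split=> //.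
  have:= tBQ; rewrite inE => /andP[/and3P[_ tI _] _].
  by apply/eqP; apply: (def_pblock tI) => //; rewrite setU11.
by move=> Q1 Q2 /BnQ nQ1 /BnQ nQ2 /(congr1 (fun Q => Q :\ B)); rewrite !setU1K.
Qed.

(** * Regions cut out by predicates on coordinates *)

Definition region E : {set cell m n} := [set x : cell m n | E x.1 x.2].

Definition ntil E : nat := #|tilings (region E)|.

Lemma eq_ntil E1 E2 :
  (forall a b, a < m -> b < n -> E1 a b = E2 a b) -> ntil E1 = ntil E2.
Proof.
by move=> eqE; rewrite /ntil; congr #|tilings _|; apply/setP=> x; rewrite !inE eqE.
Qed.

Lemma ntil0 E : (forall a b, a < m -> b < n -> E a b = false) -> ntil E = 1.
Proof.
move=> E0; rewrite /ntil; have -> : region E = set0.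
  by apply/setP => x; rewrite !inE E0.
rewrite (_ : tilings set0 = [set set0]) ?cards1 //; apply/setP => P.
rewrite !inE partition_set0; case: eqP => //= ->.
by apply/forall_inP => B; rewrite inE.
Qed.

Lemma ntil_full : ntil (fun _ _ => true) = num_tilings k m n.
Proof.
apply: eq_card => P; rewrite !inE /is_tiling.
by congr (partition _ _ && _); apply/setP=> x; rewrite !inE.
Qed.

Definition hrow (r c a b : nat) := (a == r) && (c <= b < c + k).
Definition vcol (i c a b : nat) := (b == c) && (i <= a < i + k).

Lemma horizontal_tileP B :
  reflect (exists r c, [/\ r < m, c < n, c + k <= n & B = region (hrow r c)])
          (horizontal_tile k B).
Proof.
apply: (iffP existsP) => [[i /existsP[j /andP[lejk /eqP->]]]|[r [c [lr lc lck ->]]]].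
  by exists i, j; split.
exists (Ordinal lr); apply/existsP; exists (Ordinal lc); rewrite lck.
by apply/eqP/setP => x; rewrite !inE.
Qed.

Lemma vertical_tileP B :
  reflect (exists i c, [/\ i < m, c < n, i + k <= m & B = region (vcol i c)])
          (vertical_tile k B).
Proof.
apply: (iffP existsP) => [[i /existsP[j /andP[leik /eqP->]]]|[r [c [lr lc lck ->]]]].
  by exists i, j; split.
exists (Ordinal lr); apply/existsP; exists (Ordinal lc); rewrite lck.
by apply/eqP/setP => x; rewrite !inE.
Qed.

Lemma sub_hrow r c E : r < m -> c + k <= n ->
  region (hrow r c) \subset region E = all (E r) (iota c k).
Proof.
move=> lr lck; apply/subsetP/allP => [sE b|sE [a b]].
  rewrite mem_iota => bc; have lb : b < n by lia.
  by have:= sE (Ordinal lr, Ordinal lb); rewrite !inE /= /hrow eqxx bc; apply.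
by rewrite !inE /hrow /= => /andP[/eqP-> bc]; apply: sE; rewrite mem_iota.
Qed.

Lemma sub_vcol i c E : c < n -> i + k <= m ->
  region (vcol i c) \subset region E = all (E^~ c) (iota i k).
Proof.
move=> lc lik; apply/subsetP/allP => [sE a|sE [a b]].
  rewrite mem_iota => ai; have la : a < m by lia.
  by have:= sE (Ordinal la, Ordinal lc); rewrite !inE /= /vcol eqxx ai; apply.
by rewrite !inE /vcol /= => /andP[/eqP-> ai]; apply: sE; rewrite mem_iota.
Qed.

Hypotheses (k_gt1 : 1 < k) (le_km : k <= m).

(** Sort by the tile that covers [(r, c)]. This is the first cell of [E] in row [r], so a horizontal
    tile must start there; a vertical one may start in any row [i] with [i <= r < i + k]. *)
Lemma ntil_split E r c : r < m -> c < n -> E r c ->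
    (forall b, b < c -> ~~ E r b) ->
  ntil E =
    (if (c + k <= n) && all (E r) (iota c k)
     then ntil (fun a b => E a b && ~~ hrow r c a b) else 0)
    + \sum_(i < (m - k).+1 | (i <= r < i + k) && all (E^~ c) (iota i k))
        ntil (fun a b => E a b && ~~ vcol i c a b).
Proof.
move=> lr lc Erc Er.
pose x : cell m n := (Ordinal lr, Ordinal lc).
have xE : x \in region E by rewrite inE.
have regD F : region E :\: region F = region (fun a b => E a b && ~~ F a b).
  by apply/setP => y; rewrite !inE andbC.
rewrite {1}/ntil (card_tilings_split _ _ xE) (bigID (fun B => horizontal_tile k B)) /=.
have hP B : [&& is_tile B, x \in B & B \subset region E] && horizontal_tile k B
   = [&& c + k <= n, all (E r) (iota c k) & B == region (hrow r c)].
  apply/idP/and3P => [/andP[/and3P[_ xB sB] /horizontal_tileP]|[lck aE /eqP->]].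
    case=> [r' [c' [lr' lc' lck' defB]]].
    have:= xB; rewrite defB inE /= /hrow => /andP[/eqP eqr /andP[lec ltc]].
    subst r'.
    have eqc : c' = c.
      apply/eqP; rewrite eqn_leq lec leqNgt; apply/negP => /Er/negP; apply.
      have xc' : (Ordinal lr, Ordinal lc') \in B by rewrite defB inE /= /hrow; lia.
      by have:= subsetP sB _ xc'; rewrite inE.
    by subst c'; split; rewrite -?sub_hrow -?defB.
  rewrite sub_hrow // aE /is_tile !inE /= /hrow eqxx /=.
  have hH : horizontal_tile k (region (hrow r c)).
    by apply/horizontal_tileP; exists r, c.
  by rewrite hH /=; lia.
congr (_ + _).
  case: ifP => [/andP[lck aE]|nE].
    rewrite (big_pred1 (region (hrow r c))) => [|B]; first by rewrite regD.
    by rewrite hP lck aE.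
  by rewrite big_pred0 // => B; rewrite hP andbA nE.
pose f (i : 'I_(m - k).+1) := region (vcol i c).
pose A := [set i : 'I_(m - k).+1 | (i <= r < i + k) && all (E^~ c) (iota i k)].
have leim (i : 'I_(m - k).+1) : i + k <= m by have := ltn_ord i; lia.
have finj : injective f.
  suff lef (i j : 'I_(m - k).+1) : f i = f j -> j <= i.
    by move=> i j fij; apply/val_inj/anti_leq; rewrite (lef _ _ fij) (lef j i).
  have li : i < m by have := leim i; lia.
  move=> /setP /(_ (Ordinal li, Ordinal lc)); rewrite !inE /= /vcol eqxx.
  by lia.
have -> : \sum_(i < (m - k).+1 | (i <= r < i + k) && all (E^~ c) (iota i k))
            ntil (fun a b => E a b && ~~ vcol i c a b)
          = \sum_(B in f @: A) #|tilings (region E :\: B)|.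
  rewrite big_imset /=; last by move=> i j _ _; apply: finj.
  by apply: eq_big => [i|i _]; rewrite ?inE // regD.
apply: eq_bigl => B; apply/andP/imsetP => [[/and3P[tB xB sB] nhB]|].
  have := tB; rewrite /is_tile (negbTE nhB) => /vertical_tileP[i [c' [li lc' lik defB]]].
  have:= xB; rewrite defB inE /= /vcol => /andP[/eqP eqc /andP[lei lti]]; subst c'.
  have li' : i < (m - k).+1 by lia.
  exists (Ordinal li'); rewrite /f //= inE /= lei lti /=.
  by rewrite -sub_vcol // -defB.
move=> [i]; rewrite inE => /andP[iA aE] ->.
have li := leim i.
have i0 : i < m by lia.
have i1 : i.+1 < m by lia.
split.
  rewrite sub_vcol // aE inE /= /vcol eqxx iA /is_tile !andbT orbC.
  suff -> : vertical_tile k (f i) by [].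
  by apply/vertical_tileP; exists i, c.
(* Since [k > 1], the vertical tile has cells in rows [i] and [i + 1], while a horizontal tile stays
   in one row. *)
apply/negP => /horizontal_tileP[r' [c' [_ _ _ /setP eqf]]].
have := eqf (Ordinal i0, Ordinal lc); have := eqf (Ordinal i1, Ordinal lc).
by rewrite !inE /= /vcol /hrow; lia.
Qed.

(** * Forced horizontal tiles *)

Hypothesis lt_m2k : m < 2 * k.

(* Since m < 2k, every vertical tile meets row k - 1. *)
Lemma ntil_forced E r c : r < m -> c < n -> E r c ->
    (forall b, b < c -> ~~ E r b) -> ~~ E k.-1 c ->
  ntil E = if (c + k <= n) && all (E r) (iota c k)
           then ntil (fun a b => E a b && ~~ hrow r c a b) else 0.
Proof.
move=> lr lc Erc Er Ekc; rewrite (ntil_split _ _ _ lr lc Erc Er) [X in _ + X]big1 ?addn0 //.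
move=> i /andP[_ /allP aE]; have := aE k.-1; rewrite mem_iota => aEk.
by rewrite aEk ?(negbTE Ekc) // in Ekc *; have := ltn_ord i; lia.
Qed.

(** Iterates [ntil_forced] over the rows in [s]: removing cells keeps [(k.-1, c)] out of the region,
    and as [s] has no repeats the rows still to be treated stay intact. *)
Lemma ntil_fill E c (s : seq nat) : uniq s -> c + k <= n -> ~~ E k.-1 c ->
    {in s, forall r, [/\ r < m, forall b, b < c -> ~~ E r b &
                         forall b, c <= b < c + k -> E r b]} ->
  ntil E = ntil (fun a b => E a b && ~~ ((a \in s) && (c <= b < c + k))).
Proof.
move=> + lck; elim: s E => [|r s IHs] E /=.
  by move=> *; apply: eq_ntil => a b _ _; rewrite andbT.
move=> /andP[rns us] Ek sP.
have [lr Er1 Er2] := sP r (mem_head _ _).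
have lc : c < n by lia.
have Erc : E r c by apply: Er2; lia.
rewrite (ntil_forced _ _ _ lr lc Erc Er1 Ek) lck /=.
have -> : all (E r) (iota c k) by apply/allP => b; rewrite mem_iota => /Er2.
rewrite IHs //; last 2 first.
- by rewrite (negbTE Ek).
- move=> r' sr'; have [lr' Er'1 Er'2] := sP r' (mem_behead (s := r :: s) sr').
  have nr : r' != r by apply: contraNneq rns => <-.
  by split=> // b; rewrite /hrow (negbTE nr) andbT; [apply: Er'1 | apply: Er'2].
apply: eq_ntil => a b _ _; rewrite in_cons /hrow.
by case: (E a b); case: (a == r); case: (a \in s); case: (c <= b < c + k).
Qed.

(* For j := q - p in [0, k[, the only shapes reached when the vertical tiles are
   placed from left to right: j more vertical tiles must be placed in rows
   i, ..., i + k - 1 before the left boundary is straight again. *)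
Definition notched (i p q a b : nat) := (if i <= a < i + k then p else q) <= b.

Definition nnotched i p q := ntil (notched i p q).

Lemma nnotched_all i : nnotched i n n = 1.
Proof. by apply: ntil0 => a b _ ltbn; rewrite /notched if_same leqNgt ltbn. Qed.

(** * Recurrences for notched regions *)

Hypothesis lt_km : k < m.

(** Row [k.-1] is among rows [i, ..., i + k - 1], which start only at [p > q]; so no vertical tile
    can use column [q], and each outer row takes a horizontal tile. *)
Lemma nnotched_outer i p q : i + k <= m -> q < p -> q < n ->
  nnotched i p q = if q + k <= n then nnotched i p (q + k) else 0.
Proof.
move=> lik ltqp ltqn.
have Ek : ~~ notched i p q k.-1 q by rewrite /notched; case: ifP; lia.
case: ifP => lqk; last first.
  (* An outer row exists as [k < m]; its first cell cannot be covered when [q + k > n]. *)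
  have [r [lr /negbTE ir]] : exists r, r < m /\ ~~ (i <= r < i + k).
    by case: i {Ek} lik => [|i] _; [exists k | exists 0]; split; lia.
  rewrite /nnotched (ntil_forced (notched i p q) r q lr ltqn) ?lqk //;
    by rewrite /notched ir // => b; lia.
rewrite /nnotched (ntil_fill _ q [seq r <- iota 0 m | ~~ (i <= r < i + k)]) //.
- apply: eq_ntil => a b la lb.
  by rewrite mem_filter mem_iota /notched; case: ifP => iak /=; lia.
- by rewrite filter_uniq ?iota_uniq.
move=> r; rewrite mem_filter mem_iota => /andP[/negbTE ir lr].
by rewrite /notched ir; split; lia.
Qed.

(** Decided by the tile over [(k.-1, p)]. If it is horizontal, column [p] has no vertical tile, so
    all [k] inner rows advance by [k]. If vertical, it must fit the notch, unless [p = q], when it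
    may start in any row [i' <= m - k]. *)
Lemma nnotched_strip i p q : i + k <= m -> p <= q < p + k -> p < n ->
  nnotched i p q =
    (if p + k <= n then nnotched i (p + k) q else 0)
    + if p == q then \sum_(i' < (m - k).+1) nnotched i' p.+1 p
      else nnotched i p.+1 q.
Proof.
move=> lik pq ltpn.
have lk : k.-1 < m by lia.
(* Here [i <= m - k < k], by [m < 2 * k]. *)
have kin : i <= k.-1 < i + k by lia.
have Ek b : notched i p q k.-1 b = (p <= b) by rewrite /notched kin.
rewrite {1}/nnotched (ntil_split _ k.-1 p lk ltpn) ?Ek //; last first.
  by move=> b; rewrite Ek; lia.
have -> : all (notched i p q k.-1) (iota p k).
  by apply/allP => b; rewrite mem_iota Ek; lia.
rewrite andbT; congr (_ + _).
  case: ifP => // lpk.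
  rewrite (ntil_fill _ p [seq r <- iota i k | r != k.-1]) //.
  - apply: eq_ntil => a b la lb.
    by rewrite mem_filter mem_iota /notched /hrow; case: ifP => iak /=; lia.
  - by rewrite filter_uniq ?iota_uniq.
  - by rewrite Ek /hrow; lia.
  move=> r; rewrite mem_filter mem_iota => /andP[/negbTE rk ir].
  by rewrite /notched /hrow rk ir; split; lia.
case: eqP => [eqpq|/eqP neq].
  subst q; apply: eq_big => [i'|i' _].
    have li' := ltn_ord i'.
    rewrite (_ : _ <= _ < _); last by lia.
    by apply/allP => a _; rewrite /notched if_same.
  by apply: eq_ntil => a b _ _; rewrite /notched /vcol if_same; case: ifP; lia.
have li : i < (m - k).+1 by lia.
rewrite (big_pred1 (Ordinal li)) => [|i'].
  by apply: eq_ntil => a b _ _; rewrite /notched /vcol /=; case: ifP; lia.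
have li' := ltn_ord i'.
apply/andP/eqP => [[_ /allP aE]|->].
  apply/val_inj => /=.
  (* Both end cells of the vertical tile lie in inner rows, since outer rows start at [q > p]; hence
     [i' = i]. *)
  have := aE i'; have := aE (i' + k.-1); rewrite !mem_iota /notched.
  by case: ifP; case: ifP; lia.
split; first by [].
by apply/allP => a; rewrite mem_iota /notched => ->.
Qed.

End TilingsOfRegions.

Local Open Scope ring_scope.

(** * Products and quotients of power series *)

Section PowerSeriesQuotients.

Variable R : comUnitRingType.
Implicit Types (p q : {poly R}) (f g : fps R).

(** Coefficient [n] only involves [f] up to degree [n], so [f] is replaced by its truncation [F] and
    associativity of polynomials applies. *)
Lemma fps_mul_polyM p q f n :
  fps_mul (fps_of_poly (p * q)) f n =
  fps_mul (fps_of_poly p) (fps_mul (fps_of_poly q) f) n.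
Proof.
pose F := \poly_(i < n.+1) f i.
have trF r i : (i <= n)%N -> fps_mul (fps_of_poly r) f i = (r * F)`_i.
  move=> lein; rewrite coefM; apply: eq_bigr => j _.
  by rewrite coef_poly ifT //; have := ltn_ord j; lia.
rewrite trF // -mulrA coefM; apply: eq_bigr => i _; rewrite trF //; lia.
Qed.

Lemma fps_div_polyM p q g n :
  fps_div (fps_of_poly (p * q)) g n =
  fps_mul (fps_of_poly p) (fps_div (fps_of_poly q) g) n.
Proof. exact: fps_mul_polyM. Qed.

Lemma fps_mul_polyDZXn p c k f n :
  fps_mul (fps_of_poly (p + c *: 'X^k)) f n =
  fps_mul (fps_of_poly p) f n + (if (k <= n)%N then c * f (n - k)%N else 0).
Proof.
pose F := \poly_(i < n.+1) f i.
have trF r : fps_mul (fps_of_poly r) f n = (r * F)`_n.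
  rewrite coefM; apply: eq_bigr => j _.
  by rewrite coef_poly ifT //; have := ltn_ord j; lia.
rewrite !trF mulrDl coefD -scalerAl coefZ coefXnM coef_poly ltnS leq_subr.
by case: leqP; rewrite ?mulr0.
Qed.

Lemma fps_mul_poly1 f n : fps_mul (fps_of_poly 1) f n = f n.
Proof.
rewrite /fps_mul big_ord_recl big1 => [|i _]; rewrite /fps_of_poly coef1 /=.
  by rewrite mul1r subn0 addr0.
by rewrite mul0r.
Qed.

Lemma fps_mul_polyBXn k f n :
  fps_mul (fps_of_poly (1 - 'X^k)) f n =
  f n - (if (k <= n)%N then f (n - k)%N else 0).
Proof.
rewrite -scaleN1r fps_mul_polyDZXn fps_mul_poly1; congr (_ + _).
by case: ifP => _; rewrite ?mulN1r ?oppr0.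
Qed.

End PowerSeriesQuotients.

(** * Counts as coefficients of the quotients *)

Section Coefficients.

Variables k m : nat.
Hypotheses (k_gt1 : (1 < k)%N) (lt_km : (k < m)%N) (lt_m2k : (m < 2 * k)%N).

Definition denom : {poly int} := (1 - 'X^k) ^+ k - (m - k + 1)%N%:R *: 'X^k.

(** [quot (k.-1 - d)] is the series B_d of a notch of depth d; [quotS] and [quot_k] give its two
    functional equations. *)
Definition quot j : fps int :=
  fps_div (fps_of_poly ((1 - 'X^k) ^+ j)) (fps_of_poly denom).

Lemma fps_div_denom n :
  fps_div (fps_of_poly denom) (fps_of_poly denom) n = (n == 0%N)%:R.
Proof.
rewrite /fps_div fps_mulfV /fps_of_poly ?coef1 // /denom.
(* The constant coefficient of [denom] is 1, as [k > 0]. *)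
rewrite -horner_coef0 !hornerE expr0n gtn_eqF ?(ltnW k_gt1) //.
by rewrite mulr0 !subr0 expr1n unitr1.
Qed.

Lemma quotS j n :
  quot j.+1 n = quot j n - (if (k <= n)%N then quot j (n - k)%N else 0).
Proof. by rewrite /quot exprS fps_div_polyM fps_mul_polyBXn. Qed.

Lemma quot_k n :
  quot k n = (n == 0%N)%:R
             + (if (k <= n)%N then (m - k + 1)%N%:R * quot 0%N (n - k)%N else 0).
Proof.
rewrite {1}/quot; have -> : (1 - 'X^k) ^+ k = denom + (m - k + 1)%N%:R *: 'X^k.
  by rewrite subrK.
rewrite {1}/fps_div fps_mul_polyDZXn -/(fps_div _ _ _) fps_div_denom.
congr (_ + _); case: ifP => // _.
by rewrite /quot expr0 /fps_div fps_mul_poly1.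
Qed.

(** Induction on [n - p], since each use of [nnotched_strip] advances [p]. The notch has depth
    [q - p], with [n - q] columns to its right. *)
Lemma nnotchedE n i p q : (i + k <= m)%N -> (p <= q <= n)%N -> (q < p + k)%N ->
  (nnotched k m n i p q)%:R = quot (k.-1 - (q - p))%N (n - q)%N.
Proof.
have [N] := ubnP (n - p); elim: N i p q => // N IHN i p q leN lik pqn lqk.
have [eqp|ltpn] := eqVneq p n.
  have -> : q = n by lia.
  subst p; rewrite nnotched_all !subnn subn0.
  have := quotS k.-1 0; rewrite prednK; last by lia.
  by rewrite quot_k eqxx leqn0 gtn_eqF; last lia; rewrite addr0 subr0.
rewrite nnotched_strip //; try lia.
(* Moving the inner rows by [k] forces the outer rows to follow, which restores the depth: this is
   the term x^k B_d. *)
have -> : (if (p + k <= n)%N then nnotched k m n i (p + k) q else 0%N)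
    = (if (q + k <= n)%N then nnotched k m n i (p + k) (q + k) else 0%N).
  case: ifP => [lpk|]; last by case: ifP; lia.
  by rewrite nnotched_outer //; lia.
have hor : (if (q + k <= n)%N then nnotched k m n i (p + k) (q + k) else 0%N)%:R
   = if (k <= n - q)%N then quot (k.-1 - (q - p))%N (n - q - k)%N else 0.
  have -> : (k <= n - q)%N = (q + k <= n)%N by lia.
  case: ifP => // lqkn; rewrite IHN //; try lia.
  by congr quot; lia.
rewrite natrD hor; case: eqP => [eqpq|neq].
  subst q; rewrite subnn subn0.
  have ver (i' : 'I_(m - k).+1) : true ->
      (nnotched k m n i' p.+1 p)%:R
      = if (k <= n - p)%N then quot 0%N (n - p - k)%N else 0.
    move=> _; have li' := ltn_ord i'.
    have -> : (k <= n - p)%N = (p + k <= n)%N by lia.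
    rewrite nnotched_outer //; try lia.
    case: ifP => // lpkn; rewrite IHN //; try lia.
    by congr quot; lia.
  rewrite natr_sum (eq_bigr _ ver) sumr_const card_ord.
  (* Coefficient [n - p] of u B_0 = 1 + M x^k B_(k-1); the 1 drops out because [p < n]. *)
  have := quotS k.-1 (n - p)%N; rewrite prednK; last by lia.
  rewrite quot_k subn_eq0 leqNgt (_ : (p < n)%N = true); last by lia.
  move/esym/eqP; rewrite subr_eq => /eqP->; rewrite add0r addrC.
  congr (_ + _); rewrite addn1.
  by case: ifP => _; rewrite ?mul0rn // mulr_natl.
rewrite IHN //; try lia.
have -> : (k.-1 - (q - p.+1) = (k.-1 - (q - p)).+1)%N by lia.
by rewrite quotS addrC subrK.
Qed.

End Coefficients.

Theorem theorem2p8 (k m : nat) (hk : (0 < k)%N) (hkm : (k < m)%N)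
    (hm2k : (m < 2 * k)%N) :
  (fun n : nat => (num_tilings k m n)%:R : int) =1
  fps_div (fps_of_poly ((1 - 'X^k) ^+ (k - 1)%N : {poly int}))
          (fps_of_poly ((1 - 'X^k) ^+ k - (m - k + 1)%N%:R *: 'X^k : {poly int})).
Proof.
(* [k = 1] would give [1 < m < 2]. *)
move=> n; have k_gt1 : (1 < k)%N by lia.
have lkm : (0 + k <= m)%N by lia.
have le0n : (0 <= 0 <= n)%N by [].
have lt0k : (0 < 0 + k)%N by [].
(* The full rectangle is the region with [p = q = 0], of depth 0, for any choice of [i]. *)
have := nnotchedE k m k_gt1 hkm hm2k n 0 0 0 lkm le0n lt0k.
rewrite !subn0 -subn1 /quot /denom => <-.
congr (_%:R); rewrite -ntil_full; apply: eq_ntil => a b _ _.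
by rewrite /notched if_same.
Qed.
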